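(* For $n\ge 2$ let $s(n;\Sigma_2)$ be the number of sparse paving matroids $M$ on ground set $[n]$ such that some transposition of $[n]$ is an automorphism of $M$, and let $s(n)$ be the number of sparse paving matroids on ground set $[n]$. Then $$\lim_{n\to\infty}\frac{s(n;\Sigma_2)}{s(n)}=0.$$
   Context: A matroid of rank $r$ is sparse paving if every $r$-element non-basis is a circuit-hyperplane. An automorphism of a matroid $M$ on $[n]$ is a permutation $\pi$ of $[n]$ such that $X$ is a basis if and only if $\pi(X)$ is a basis, for all $X\subseteq[n]$. A transposition exchanges two elements and fixes all others. *)

(* Defs.v *)
From HB Require Import structures.
From mathcomp Require Import all_boot all_fingroup.

Set Implicit Arguments.
Unset Strict Implicit.
Unset Printing Implicit Defensive.

Section Matroid.
Variable T : finType.

Definition basis_axiom (BB : {set {set T}}) : bool :=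
  (BB != set0) &&
  [forall A in BB, forall B in BB, forall a in A :\: B,
     exists b in B :\: A, b |: (A :\ a) \in BB].

Record matroid := Matroid {
  bases : {set {set T}};
  _ : basis_axiom bases }.

HB.instance Definition _ := [isSub for bases].
HB.instance Definition _ := [Finite of matroid by <:].

Variable M : matroid.

Definition independent (X : {set T}) : bool := [exists B in bases M, X \subset B].

Definition rk (X : {set T}) : nat := \max_(B in bases M) #|X :&: B|.

Definition rank : nat := rk [set: T].

Definition circuit (X : {set T}) : bool := minset (fun Y => ~~ independent Y) X.

Definition flat (X : {set T}) : bool := [forall e in ~: X, rk X < rk (e |: X)].

(* Written additively so that no hyperplane exists in rank 0. *)
Definition hyperplane (X : {set T}) : bool := flat X && ((rk X).+1 == rank).

Definition sparse_paving : bool :=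
  [forall X : {set T},
     (#|X| == rank) && (X \notin bases M) ==> circuit X && hyperplane X].

Definition automorphism (p : {perm T}) : bool :=
  [forall X : {set T}, (X \in bases M) == (p @: X \in bases M)].

End Matroid.

Definition transposition (T : finType) (p : {perm T}) : bool :=
  [exists i, exists j, (i != j) && (p == tperm i j)].

Definition s (n : nat) : nat := #|[set M : matroid 'I_n | sparse_paving M]|.

Definition s_Sigma2 (n : nat) : nat :=
  #|[set M : matroid 'I_n | sparse_paving M &&
       [exists p : {perm 'I_n}, transposition p && automorphism M p]]|.

(* Main.v *)
(** The sparse paving matroids of rank [r], [0 < r < n], correspond to the
    families of [r]-sets no two of which differ by one exchange ("codes"), via
    their non-bases. If the transposition [(i j)] is an automorphism, every
    non-basis contains both or none of [i] and [j]: otherwise it would be one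
    exchange away from its image.

    Fix such a code [S], and an [r]-set [A] containing [i] but not [j]. The only
    words of [S] that can be one exchange away from [A] are one of the form
    [A - i + y] and one of the form [A - x + j]. Deleting these and adding [A]
    yields a code which determines [A], and determines [S] up to [(n + 1)^2]
    possibilities. Hence the codes arising from [(i j)] are at most a fraction
    [(n + 1)^2 / 'C(n - 2, r - 1)] of all codes, which is negligible even after
    summing over the pairs [i, j], unless [r] is so extreme that ['C(n, r)] is
    polynomial in [n]. Such ranks contribute at most [2 ^ poly(n)] matroids,
    whereas the Graham-Sloane codes yield [2 ^ (2 ^ n / poly(n))]. *)

Require Import Defs.
From mathcomp Require Import all_boot all_fingroup zify.

Set Implicit Arguments.
Unset Strict Implicit.
Unset Printing Implicit Defensive.

(** * Single exchanges between finite sets *)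

Section Exchange.
Variable T : finType.
Implicit Types A B C : {set T}.

Lemma cardsU1D1 A a b : a \in A -> b \notin A -> #|b |: (A :\ a)| = #|A|.
Proof.
by move=> aA bA; rewrite cardsU1 (cardsD1 a A) aA !inE negb_and bA orbT.
Qed.

Lemma setD_swap A a b :
  a \in A -> b \notin A -> A :\: (b |: (A :\ a)) = [set a].
Proof.
move=> aA bA; apply/setP=> x; rewrite !inE.
case: (eqVneq x a) => [->|xa] /=.
  by rewrite aA !orbF andbT; apply: contraNneq bA => <-.
by case: (x \in A); rewrite ?andbF //= orbT.
Qed.

Lemma swap_setD A B : #|A| = #|B| -> #|A :\: B| == 1 ->
  exists a b, [/\ a \in A, a \notin B, b \notin A, b \in B & B = b |: (A :\ a)].
Proof.
move=> cAB /cards1P[a Aa].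
have: #|B :\: A| == 1.
  have := cardsID B A; have := cardsID A B; rewrite Aa cards1 setIC cAB; lia.
case/cards1P=> b Bb.
have := set11 a; rewrite -Aa inE => /andP[aB aA].
have := set11 b; rewrite -Bb inE => /andP[bA bB].
exists a, b; split=> //; apply/setP=> x.
have /setP/(_ x) := Aa; have /setP/(_ x) := Bb; rewrite !inE => <- <-.
by case: (x \in A); case: (x \in B).
Qed.

Lemma setD_swap2 A a b b' : a \in A -> b \notin A -> b' \notin A -> b != b' ->
  #|(b |: (A :\ a)) :\: (b' |: (A :\ a))| = 1.
Proof.
move=> aA bA b'A bb'; apply/eqP/cards1P; exists b; apply/setP=> x; rewrite !inE.
case: (eqVneq x b) => [->|_] /=; last by case: (x != a); case: (x \in A); rewrite ?orbT ?andbF.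
by rewrite (negPf bb') (negPf bA) andbF.
Qed.

Lemma setD_swap2l A a a' b : a \in A -> a' \in A -> b \notin A -> a != a' ->
  #|(b |: (A :\ a)) :\: (b |: (A :\ a'))| = 1.
Proof.
move=> aA a'A bA aa'; apply/eqP/cards1P; exists a'; apply/setP=> x; rewrite !inE.
case: (eqVneq x a') => [->|xa'] /=.
  rewrite a'A [a' == a]eq_sym aa' orbT andbT orbF.
  by apply: contraNneq bA => <-.
by case: (x == b); case: (x \in A); rewrite ?andbF.
Qed.

End Exchange.

(** * Codes and the non-bases of sparse paving matroids *)

Section Codes.
Variable T : finType.
Implicit Types (A B : {set T}) (S : {set {set T}}) (M : matroid T).

(** For sets of equal size, [#|A :\: B| = 1] is adjacency in the Johnson graph. A code is thus a
    stable set there, or a constant weight code of distance at least 4. *)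
Definition code (r : nat) (S : {set {set T}}) : bool :=
  [forall A in S, #|A| == r] && [forall A in S, forall B in S, #|A :\: B| != 1].

Lemma codeP r S :
  reflect ((forall A, A \in S -> #|A| = r) /\
           (forall A B, A \in S -> B \in S -> #|A :\: B| != 1)) (code r S).
Proof.
apply: (iffP andP) => [[/forall_inP h1 /forall_inP h2]|[h1 h2]]; split.
- by move=> A /h1/eqP.
- by move=> A B AS BS; move/forall_inP: (h2 A AS) => /(_ B BS).
- by apply/forall_inP=> A /h1/eqP.
- by apply/forall_inP=> A AS; apply/forall_inP=> B; apply: h2.
Qed.

Lemma basis_exchange M A B a : A \in bases M -> B \in bases M ->
  a \in A :\: B -> exists2 b, b \in B :\: A & b |: (A :\ a) \in bases M.
Proof.
case: M => BB /= /andP[_ /forall_inP h] AB BBB aAB.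
move/forall_inP: (h A AB) => /(_ B BBB)/forall_inP/(_ a aAB)/exists_inP[b hb hB].
by exists b.
Qed.

Lemma bases_neq0 M : exists B, B \in bases M.
Proof. by case: M => BB /= /andP[/set0Pn]. Qed.

(** Exchanging an element of [A :\: B] keeps the size of [A] and brings it closer to [B]. Once [A]
    lies inside [B], an element of [B :\: A] would have to be exchanged for one of the empty set
    [A :\: B]. *)
Lemma basis_card_eq M A B : A \in bases M -> B \in bases M -> #|A| = #|B|.
Proof.
have [k] := ubnP #|A :\: B|; elim: k A => // k IH A ltk hA hB.
have [/eqP|[a aAB]] := set_0Vmem (A :\: B).
  rewrite setD_eq0 => sAB.
  have [/eqP|[b bBA]] := set_0Vmem (B :\: A).
    by rewrite setD_eq0 => sBA; congr #|pred_of_set _|; apply/eqP; rewrite eqEsubset sAB.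
  have [a] := basis_exchange hB hA bBA.
  by rewrite inE => /andP[/negP aB /(subsetP sAB)].
have [b bBA hA'] := basis_exchange hA hB aAB.
move: (aAB) (bBA); rewrite !inE => /andP[aB aA] /andP[bA bB].
rewrite -(cardsU1D1 aA bA); apply: IH => //.
rewrite -ltnS; apply: leq_trans ltk; rewrite ltnS.
apply: proper_card; apply/properP; split.
  by apply/subsetP=> x; rewrite !inE;
     case: eqVneq => [->|_] /=; [rewrite bB|case/and3P=> -> _ ->].
by exists a; rewrite // !inE eqxx aB /= orbF; apply: contraNneq bA => <-.
Qed.

Lemma card_basis M B : B \in bases M -> #|B| = rank M.
Proof.
move=> hB; apply/eqP; rewrite eqn_leq; apply/andP; split.
  by rewrite /rank /rk -{1}(setTI B); apply: (leq_bigmax_cond B).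
by apply/bigmax_leqP=> C hC; rewrite setTI (basis_card_eq hC hB).
Qed.

Lemma rank_le M : rank M <= #|T|.
Proof. by have [B hB] := bases_neq0 M; rewrite -(card_basis hB) max_card. Qed.

Definition nonbases M : {set {set T}} :=
  [set X : {set T} | (#|X| == rank M) && (X \notin bases M)].

Lemma nonbases_inj M M' :
  rank M = rank M' -> nonbases M = nonbases M' -> M = M'.
Proof.
move=> er eN; apply/val_inj/setP=> X /=.
have [cX|cX] := eqVneq #|X| (rank M).
  by move/setP/(_ X): eN; rewrite !inE -er cX eqxx /= => /negb_inj.
transitivity false; first by apply: contraNF cX => /card_basis ->.
by apply/esym; apply: contraNF cX => /card_basis ->; rewrite er.
Qed.

(** Suppose [A] and [B = A - a + b] are non-bases. As [A] is a hyperplane, [A + b] contains a basis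
    [C]; as [A] is a circuit, [A - a] extends to a basis [C' = A - a + x]. Exchanging [x] for some
    [y] in [C] forces [y] to be [a] or [b], so that [A] or [B] would be a basis. *)
Lemma nonbases_code M : sparse_paving M -> code (rank M) (nonbases M).
Proof.
move=> /forallP sp; apply/codeP; split=> [A|A B]; first by rewrite inE => /andP[/eqP].
rewrite !inE => hA hB; apply/negP=> cAB.
have/andP[/minsetP[_ circA] /andP[/forall_inP flatA /eqP rkA]] := implyP (sp A) hA.
case/andP: hA => /eqP cA nA; case/andP: hB => /eqP cB nB.
have [a [b [aA aB bA bB eB]]] := swap_setD (etrans cA (esym cB)) cAB.
(* A basis inside [A + b], as [A] is a hyperplane. *)
have [C hC CAb]: exists2 C, C \in bases M & C \subset b |: A.
  have := flatA b; rewrite inE => /(_ bA).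
  rewrite -ltnS rkA ltnS {1}/rk => hrk.
  have [C0 hC0] := bases_neq0 M.
  have : exists2 C, C \in bases M & rank M <= #|(b |: A) :&: C|.
    apply/exists_inP; apply: contraLR hrk; rewrite negb_exists_in => /forall_inP h.
    rewrite -ltnNge.
    case er: (rank M) rkA => [|k] // _; rewrite ltnS; apply/bigmax_leqP=> C hC.
    by have := h C hC; rewrite er -ltnNge ltnS.
  case=> C hC hrC; exists C => //; apply/setIidPr/eqP.
  by rewrite eqEcard subsetIr /= (card_basis hC).
have [C' hC' DC']: exists2 C', C' \in bases M & A :\ a \subset C'.
  have [iD|nD] := boolP (independent M (A :\ a)).
    by case/exists_inP: iD => C' ? ?; exists C'.
  have := circA _ nD (subsetDl _ _) => /setP/(_ a).
  by rewrite !inE eqxx aA.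
have [x xC' xD]: exists2 x, x \in C' & x \notin A :\ a.
  apply/subsetPn; apply/negP=> /subset_leq_card.
  by rewrite (card_basis hC') -cA (cardsD1 a A) aA ltnn.
have eC' : C' = x |: (A :\ a).
  apply/esym/eqP; rewrite eqEcard subUset sub1set xC' DC' /=.
  by rewrite cardsU1 xD (card_basis hC') -cA (cardsD1 a A) aA.
have noext y : y \in C -> y |: (A :\ a) \in bases M -> y \notin A :\ a -> False.
  move=> yC hy; rewrite !inE negb_and negbK; have := subsetP CAb y yC.
  rewrite !inE => /orP[/eqP yb|yA]; first by move=> _; move: nB; rewrite eB -yb hy.
  by rewrite yA orbF => /eqP ya; move: hy; rewrite ya setD1K // (negPf nA).
have xC : x \notin C by apply/negP=> xC; apply: (noext x xC) => //; rewrite -eC'.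
have xC'C : x \in C' :\: C by rewrite inE xC.
have [y] := basis_exchange hC' hC xC'C.
have -> : C' :\ x = A :\ a by rewrite eC' setU1K.
rewrite inE eC' in_setU1 negb_or => /andP[/andP[_ yD] yC] hy.
exact: (noext y).
Qed.

(** * The sparse paving matroid of a code *)

Section CodeMatroid.
Variables (r : nat) (S : {set {set T}}).
Hypotheses (r_gt0 : 0 < r) (r_lt : r < #|T|) (S_code : code r S).

Definition code_bases : {set {set T}} := [set X : {set T} | (#|X| == r) && (X \notin S)].

Lemma swap_notin A a b :
  A \in S -> a \in A -> b \notin A -> b |: (A :\ a) \in code_bases.
Proof.
move=> AS aA bA; have [cS dS] := codeP _ _ S_code.
rewrite inE cardsU1D1 // (cS A) // eqxx /=; apply/negP=> hS.
by have := dS _ _ AS hS; rewrite setD_swap // cards1.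
Qed.

Lemma card_word_gt0 A : A \in S -> exists a, a \in A.
Proof.
have [cS _] := codeP _ _ S_code; move=> /cS cA.
by apply/set0Pn; rewrite -card_gt0 cA.
Qed.

Lemma card_word_ltT A : A \in S -> exists a, a \notin A.
Proof.
have [cS _] := codeP _ _ S_code; move=> /cS cA.
suff/set0Pn[a]: ~: A != set0 by rewrite inE; exists a.
by rewrite -card_gt0 cardsCs setCK subn_gt0 cA.
Qed.

(** If no exchange of [a] succeeds, every [A - a + b] with [b] in [B :\: A] is a word. Two of these
    would be one exchange apart, so there is a single [b]; then [A - a + b] is [B] itself, which is
    not a word. *)
Lemma code_basis_axiom : basis_axiom code_bases.
Proof.
have [cS dS] := codeP _ _ S_code.
apply/andP; split.
  have [S0|[A AS]] := set_0Vmem S.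
    have : 0 < #|[set X : {set T} | #|X| == r]| by rewrite card_draws bin_gt0 ltnW.
    rewrite card_gt0 => /set0Pn[X]; rewrite inE => cX; apply/set0Pn; exists X.
    by rewrite inE cX S0 inE.
  have [[a aA] [b bA]] := (card_word_gt0 AS, card_word_ltT AS).
  by apply/set0Pn; exists (b |: (A :\ a)); apply: swap_notin.
apply/forall_inP=> A hA; apply/forall_inP=> B hB; apply/forall_inP=> a.
rewrite inE => /andP[aB aA]; move: hA hB.
rewrite !inE => /andP[/eqP cA nA] /andP[/eqP cB nB].
apply/exists_inP; apply/exists_inP; apply: contraT; rewrite negb_exists_in => /forall_inP h.
have inS b : b \in B :\: A -> b |: (A :\ a) \in S.
  move=> hb; have := h b hb; rewrite inE cardsU1D1 ?cA ?eqxx ?negbK //.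
  by move: hb; rewrite inE => /andP[].
have cBA : #|B :\: A| = #|A :\: B|.
  have := cardsID B A; have := cardsID A B; rewrite setIC; lia.
have [|c1] := leqP #|A :\: B| 1.
  rewrite leq_eqVlt ltnS leqn0 cards_eq0 orbC => /orP[/eqP/setP/(_ a)|c1].
    by rewrite !inE aA aB.
  have [a' [b [a'A a'B bA bB eB]]] := swap_setD (etrans cA (esym cB)) c1.
  move: c1 => /cards1P[z Ez].
  have /setP/(_ a) := Ez; have /setP/(_ a') := Ez; rewrite !inE aB aA a'A a'B /=.
  move=> /esym/eqP ea' /esym/eqP ea; rewrite -ea in ea'; rewrite ea' in eB.
  by have := inS b; rewrite inE bA bB -eB (negPf nB) => /(_ isT).
rewrite -cBA in c1; have [b [b' [hb hb' bb']]] := card_gt1P c1.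
have := dS _ _ (inS b hb) (inS b' hb'); rewrite setD_swap2 //.
- by move: hb; rewrite inE => /andP[].
- by move: hb'; rewrite inE => /andP[].
Qed.

Definition code_matroid : matroid T := Matroid code_basis_axiom.

Lemma rank_code_matroid : rank code_matroid = r.
Proof.
have [B hB] := bases_neq0 code_matroid.
by rewrite -(card_basis hB); move: hB; rewrite inE => /andP[/eqP].
Qed.

Lemma nonbases_code_matroid : nonbases code_matroid = S.
Proof.
have [cS _] := codeP _ _ S_code.
apply/setP=> X; rewrite !inE rank_code_matroid.
have [_|nX] := eqVneq #|X| r; rewrite /= ?negbK //.
by apply/esym; apply: contraNF nX => /cS ->.
Qed.

(** Every single exchange applied to a word gives a basis. Hence dropping any element of the word
    leaves an independent set, and adding any element raises the rank to [r]. *)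
Lemma code_matroid_sparse_paving : sparse_paving code_matroid.
Proof.
have [cS dS] := codeP _ _ S_code.
apply/forallP=> X; apply/implyP=> hX.
have {hX} XS : X \in S by rewrite -nonbases_code_matroid inE.
have cX := cS _ XS.
have XnB B : B \in code_bases -> ~~ (X \subset B).
  rewrite inE => /andP[/eqP cB nB]; apply: contraNN nB => sXB.
  suff -> : B = X by [].
  by apply/esym/eqP; rewrite eqEcard sXB cX cB /=.
have [[x0 x0X] [y0 y0X]] := (card_word_gt0 XS, card_word_ltT XS).
have rkX : (rk code_matroid X).+1 = r.
  rewrite -(prednK r_gt0); congr _.+1; apply/eqP; rewrite eqn_leq; apply/andP; split.
    apply/bigmax_leqP=> B hB; rewrite -ltnS prednK // -cX; apply: proper_card.
    by rewrite properE subsetIl subsetI subxx /= XnB.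
  apply: leq_trans (leq_bigmax_cond (y0 |: (X :\ x0)) _); last exact: swap_notin.
  rewrite -cX (cardsD1 x0 X) x0X /=; apply: subset_leq_card.
  by rewrite subsetI subsetDl subsetUr.
apply/andP; split.
  apply/minsetP; split.
    by apply/negP=> /exists_inP[B /XnB/negP].
  move=> Y nY sYX; apply/eqP; apply: contraR nY => YX.
  have /properP[_ [x xX xY]] : Y \proper X by rewrite properEneq YX.
  apply/exists_inP; exists (y0 |: (X :\ x)); first exact: swap_notin.
  by apply: subset_trans (subsetUr _ _); rewrite subsetD1 sYX.
apply/andP; split; last by rewrite rkX rank_code_matroid.
apply/forall_inP=> e; rewrite inE => eX; rewrite rkX.
apply: leq_trans (leq_bigmax_cond (e |: (X :\ x0)) _); last exact: swap_notin.
rewrite -cX -(cardsU1D1 x0X eX); apply: subset_leq_card.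
by rewrite subsetI subxx andbT setUS ?subsetDl.
Qed.

End CodeMatroid.

End Codes.

(** * Switching a separating set into a code *)

Section Counting.
Variable T : finType.
Implicit Types (A B : {set T}) (S : {set {set T}}) (M : matroid T).

Definition codes r : {set {set {set T}}} := [set S | code r S].

Definition pairing_codes r (i j : T) : {set {set {set T}}} :=
  [set S in codes r | [forall A in S, (i \in A) == (j \in A)]].

Definition separating r (i j : T) : {set {set T}} :=
  [set A : {set T} | [&& i \in A, j \notin A & #|A| == r]].

Lemma card_separating r i j : 0 < r -> i != j ->
  'C(#|T| - 2, r.-1) <= #|separating r i j|.
Proof.
move=> r_gt0 ij; pose D := ~: [set i; j].
have cD : #|D| = #|T| - 2 by rewrite cardsCs setCK cards2 ij.
have notin B : B \subset D -> i \notin B /\ j \notin B.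
  by move=> sBD; split; apply/negP=> /(subsetP sBD); rewrite !inE eqxx ?orbT.
rewrite -cD -cards_draws -(card_in_imset (f := fun B => i |: B)).
  apply/subset_leq_card/subsetP=> _ /imsetP[B hB ->].
  move: hB; rewrite inE => /andP[/notin[iB jB] /eqP cB].
  rewrite !inE eqxx eq_sym (negPf ij) jB cardsU1 iB cB /=.
  by rewrite add1n prednK.
move=> B B'; rewrite !inE => /andP[/notin[iB _] _] /andP[/notin[iB' _] _] /= e.
by rewrite -(setU1K iB) e setU1K.
Qed.

(** The options record the words that [A] displaces. Each pick has at most one candidate when [SA.1]
    is a code: two words [A - i + y] would be one exchange apart, and so would two words
    [A - x + j]. *)
Definition switch i j (SA : {set {set T}} * {set T}) :
    {set {set T}} * (option T * option T) :=
  (SA.2 |: [set B in SA.1 | #|SA.2 :\: B| != 1],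
   ([pick y | (y \notin SA.2) && (y |: (SA.2 :\ i) \in SA.1)],
    [pick x | (x \in SA.2) && (j |: (SA.2 :\ x) \in SA.1)])).

Section Switch.
Variables (r : nat) (i j : T).

Lemma switch_code S A : S \in pairing_codes r i j -> A \in separating r i j ->
  (switch i j (S, A)).1 \in codes r.
Proof.
rewrite !inE => /andP[/codeP[cS dS] _] /and3P[_ _ /eqP cA].
apply/codeP; split=> [B|B C]; rewrite !inE.
  by case/predU1P=> [->//|/andP[/cS]].
have sym B' : B' \in S -> #|B' :\: A| = #|A :\: B'|.
  move=> /cS cB'; have := cardsID A B'; have := cardsID B' A; rewrite setIC; lia.
case/predU1P=> [->|/andP[BS dB]]; case/predU1P=> [->|/andP[CS dC]] //.
- by rewrite setDv cards0.
- by rewrite sym.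
- exact: dS.
Qed.

(** [A] separates [i] from [j], while the words of [S'] do not, so in the second family only [A']
    can be equal to it. *)
Lemma switch_word S S' A A' :
  S' \in pairing_codes r i j ->
  A \in separating r i j -> (switch i j (S, A)).1 = (switch i j (S', A')).1 ->
  A = A'.
Proof.
rewrite !inE => /andP[_ /forall_inP eS'] /and3P[iA jA _] /= /setP/(_ A).
rewrite !inE eqxx /= => /esym/predU1P[//|/andP[/eS']].
by rewrite iA (negPf jA).
Qed.

(** Words not one exchange away from [A] survive the switch; the others are read off the two
    options. *)
Lemma switch_sub S S' A :
  S \in pairing_codes r i j -> S' \in pairing_codes r i j ->
  A \in separating r i j -> switch i j (S, A) = switch i j (S', A) ->
  S \subset S'.
Proof.
rewrite !inE => /andP[/codeP[cS dS] /forall_inP eS] /andP[_ /forall_inP eS'].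
case/and3P=> iA jA /eqP cA [] /= eP ey ex.
apply/subsetP=> B BS; have nBA : B != A.
  by apply: contraTneq BS => ->; apply/negP=> /eS; rewrite iA (negPf jA).
have [dB|dB] := boolP (#|A :\: B| != 1).
  by move/setP/(_ B): eP; rewrite !inE (negPf nBA) BS dB => /esym/andP[].
(* [B = A - a + b] contains both or none of [i] and [j], so [a = i] or [b = j]. *)
have [a [b [aA aB bA bB eB]]] := swap_setD (etrans cA (esym (cS B BS))) (negbNE dB).
have [ai|nai] := eqVneq a i.
  move: ey; case: pickP => [y /andP[yA yS]|/(_ b)]; last first.
    by rewrite bA -ai -eB BS.
  case: pickP => [y' /andP[_ y'S] [eyy']|//].
  suff eyb : y = b by rewrite eB ai -eyb eyy'.
  apply/eqP; apply/negP=> /negP nyb; have := dS _ _ yS BS.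
  by rewrite eB ai setD_swap2 // eqxx.
have bj : b = j.
  have iB : i \in B by rewrite eB !inE [i == a]eq_sym nai iA orbT.
  by move: (eS B BS); rewrite iB eB !inE (negPf jA) andbF orbF => /eqP/esym/eqP.
move: ex; case: pickP => [x /andP[xA xS]|/(_ a)]; last first.
  by rewrite aA -bj -eB BS.
case: pickP => [x' /andP[_ x'S] [exx']|//].
suff exa : x = a by rewrite eB bj -exa exx'.
apply/eqP; apply/negP=> /negP nxa; have := dS _ _ xS BS.
by rewrite eB bj setD_swap2l // eqxx.
Qed.

Lemma switch_inj :
  {in setX (pairing_codes r i j) (separating r i j) &, injective (switch i j)}.
Proof.
move=> [S A] [S' A'] /setXP[hS hA] /setXP[hS' hA'] e.
have eA : A = A' by apply: switch_word (congr1 fst e).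
subst A'; congr (_, _); apply/eqP; rewrite eqEsubset.
by rewrite (switch_sub hS hS' hA e) (switch_sub hS' hS hA (esym e)).
Qed.

Lemma card_pairing_codes : 0 < r -> i != j ->
  #|pairing_codes r i j| * 'C(#|T| - 2, r.-1) <= #|codes r| * #|T|.+1 ^ 2.
Proof.
move=> r_gt0 ij.
apply: leq_trans (_ : #|pairing_codes r i j| * #|separating r i j| <= _).
  by rewrite leq_mul2l card_separating ?orbT.
rewrite -cardsX -(card_in_imset switch_inj).
rewrite -mulnn -card_option -card_prod -cardsT -cardsX.
apply/subset_leq_card/subsetP=> _ /imsetP[[S A] /setXP[hS hA] ->].
by apply/setXP; split; [exact: switch_code | rewrite inE].
Qed.

End Switch.

(** * From codes to matroids, rank by rank *)

Lemma imset_tperm i j A : i \in A -> j \notin A ->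
  tperm i j @: A = j |: (A :\ i).
Proof.
move=> iA jA; apply/eqP; rewrite eqEcard cardsU1D1 // (card_imset _ perm_inj) leqnn andbT.
apply/subsetP=> _ /imsetP[x xA ->]; rewrite !inE.
have [->|xi] := eqVneq x i; first by rewrite tpermL eqxx.
have xj : x != j by apply: contraNneq jA => <-.
by rewrite tpermD 1?eq_sym // xi xA orbT.
Qed.

(** A non-basis with exactly one of [i] and [j] would be mapped to a non-basis one exchange away,
    against the code property. *)
Lemma nonbases_pairing M i j : sparse_paving M -> automorphism M (tperm i j) ->
  nonbases M \in pairing_codes (rank M) i j.
Proof.
move=> spM aut; rewrite !inE nonbases_code //=.
have [_ dM] := codeP _ _ (nonbases_code spM).
have not_sep i' j' A : automorphism M (tperm i' j') -> A \in nonbases M ->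
    i' \in A -> j' \in A.
  move=> /forallP/(_ A)/eqP autA AN iA; apply: contraT => jA.
  have := dM A (j' |: (A :\ i')) AN; rewrite setD_swap // cards1; apply.
  by move: AN; rewrite !inE autA imset_tperm // cardsU1D1.
apply/forall_inP=> A AN; apply/eqP; apply/idP/idP; apply: not_sep => //.
by rewrite tpermC.
Qed.

Definition sp_rank r : {set matroid T} := [set M | sparse_paving M & rank M == r].

Definition sp_rank_transp r : {set matroid T} :=
  [set M in sp_rank r |
    [exists p : {perm T}, transposition p && automorphism M p]].

Lemma nonbases_inj_rank r : {in sp_rank r &, injective (@nonbases T)}.
Proof.
move=> M M'; rewrite !inE => /andP[_ /eqP rM] /andP[_ /eqP rM'].
by apply: nonbases_inj; rewrite rM.
Qed.

Lemma card_sp_rank_le r : #|sp_rank r| <= #|codes r|.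
Proof.
rewrite -(card_in_imset (@nonbases_inj_rank r)).
apply/subset_leq_card/subsetP=> _ /imsetP[M hM ->].
move: hM; rewrite !inE => /andP[spM /eqP <-].
exact: nonbases_code.
Qed.

Lemma card_sp_rank_ge r : 0 < r < #|T| -> #|codes r| <= #|sp_rank r|.
Proof.
case/andP=> r_gt0 r_lt; apply: leq_trans (leq_imset_card (@nonbases T) _).
apply/subset_leq_card/subsetP=> S; rewrite inE => cS.
apply/imsetP; exists (code_matroid r_gt0 r_lt cS).
  by rewrite inE rank_code_matroid eqxx code_matroid_sparse_paving.
by rewrite nonbases_code_matroid.
Qed.

Lemma card_sp_rank_transp_le r k :
  (forall i j, i != j -> #|pairing_codes r i j| <= k) ->
  #|sp_rank_transp r| <= #|T| ^ 2 * k.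
Proof.
move=> hk.
pose A (p : T * T) := if p.1 != p.2 then pairing_codes r p.1 p.2 else set0.
have inj : {in sp_rank_transp r &, injective (@nonbases T)}.
  move=> M M'; rewrite !inE => /andP[h _] /andP[h' _].
  by apply: nonbases_inj_rank; rewrite inE; eassumption.
rewrite -(card_in_imset inj).
apply: leq_trans (_ : #|\bigcup_p A p| <= _).
  apply/subset_leq_card/subsetP=> _ /imsetP[M hM ->].
  move: hM; rewrite !inE.
  case/andP=> /andP[spM /eqP rM] /existsP[p /andP[]].
  case/existsP=> [i /existsP[j /andP[ij /eqP ->]]] aut.
  by apply/bigcupP; exists (i, j); rewrite // /A /= ij -rM nonbases_pairing.
apply: leq_trans (_ : \sum_p #|A p| <= _).
  elim/big_rec2: _ => [|p S m _ h]; first by rewrite cards0.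
  by apply: leq_trans (leq_card_setU _ _) _; rewrite leq_add2l.
rewrite -mulnn -card_prod -sum_nat_const; apply: leq_sum => -[i j] _.
by rewrite /A /=; case: ifP => [/hk|_]; rewrite ?cards0.
Qed.

Lemma card_codes_le r : #|codes r| <= 2 ^ 'C(#|T|, r).
Proof.
rewrite -card_draws -card_powerset; apply/subset_leq_card/subsetP=> S.
rewrite !inE => /codeP[cS _]; apply/subsetP=> A /cS; rewrite inE => ->.
exact: eqxx.
Qed.

Lemma card_codes_ge r S : code r S -> 2 ^ #|S| <= #|codes r|.
Proof.
move=> /codeP[cS dS]; rewrite -card_powerset; apply/subset_leq_card/subsetP=> S'.
rewrite !inE => /subsetP sS; apply/codeP; split=> [A /sS|A B /sS AS /sS]; auto.
Qed.

Lemma card_by_rank (P : pred (matroid T)) :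
  #|[set M | P M]| = \sum_(r < #|T|.+1) #|[set M | P M & rank M == r]|.
Proof.
rewrite -sum1dep_card (partition_big (fun M => inord (rank M) : 'I_#|T|.+1) predT) //=.
apply: eq_bigr => r _; rewrite sum1dep_card; apply: eq_card => M; rewrite !inE.
by rewrite -val_eqE /= inordK // ltnS rank_le.
Qed.

End Counting.

(** * Existence of a large code *)

Lemma pigeonhole (aT rT : finType) (f : aT -> rT) : 0 < #|rT| ->
  exists y, #|aT| <= #|[set x | f x == y]| * #|rT|.
Proof.
move=> rT_gt0.
have [y hy] := eq_bigmax (fun y => #|[set x | f x == y]|) rT_gt0.
exists y; rewrite -hy -cardsT -sum1_card (partition_big f predT) //= mulnC -sum_nat_const.
apply: leq_sum => z _; rewrite (leq_trans _ (leq_bigmax z)) // -sum1dep_card.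
by apply: eq_leq; apply: eq_bigl => x; rewrite inE.
Qed.

(* Graham-Sloane: sets of equal size and equal element sum modulo [n] form a
   code, since an exchange changes the sum. *)
Lemma exists_large_code n : 0 < n ->
  exists r (S : {set {set 'I_n}}), code r S /\ 2 ^ n <= #|S| * (n.+1 * n).
Proof.
move=> n_gt0.
pose f (A : {set 'I_n}) : 'I_n.+1 * 'I_n :=
  (inord #|A|, Ordinal (ltn_pmod (\sum_(a in A) a) n_gt0)).
have [|[r c] hS] := @pigeonhole _ _ f.
  by rewrite card_prod !card_ord muln_gt0 n_gt0.
exists r, [set A | f A == (r, c)]; split; last first.
  by move: hS; rewrite card_prod !card_ord -cardsT -powersetT card_powerset cardsT card_ord.
have fibre A : A \in [set A | f A == (r, c)] ->
    #|A| = r /\ (\sum_(a in A) a) %% n = c.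
  rewrite inE => /eqP[<- <-] /=; rewrite inordK // ltnS -[n in _ <= n]card_ord.
  exact: max_card.
apply/codeP; split=> [A /fibre[]//|A B /fibre[cA sA] /fibre[cB sB]].
apply/negP=> dAB; have [a [b [aA aB bA bB eB]]] := swap_setD (etrans cA (esym cB)) dAB.
move: sB; rewrite -sA eB big_setU1 ?inE ?(negPf bA) ?andbF //= (big_setD1 a aA) /=.
(* Cancelling the sum over [A :\ a] leaves [b] and [a] congruent modulo [n]; both are below [n],
   hence equal. *)
move/eqP; rewrite eqn_modDr !modn_small // => /eqP/val_inj eba.
by rewrite eba aA in bA.
Qed.

(** * Numerical estimates *)

Lemma leq_bin_middle n r : 0 < r < n -> 'C(n, r) <= n ^ 2 * 'C(n - 2, r.-1).
Proof.
case: r => // q /= lt_q; have := mul_bin_diag n q; have := mul_bin_down n.-1 q.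
have -> : n.-1.-1 = n - 2 by lia.
rewrite -mulnn; nia.
Qed.

(** If ['C(n - 2, r.-1)] is at least [n.+1 ^ 5], each pair [i, j] accounts for at most a fraction
    [1 / n.+1 ^ 3] of the codes, and there are [n ^ 2] pairs. Otherwise ['C(n, r)] is at most
    [n.+1 ^ 7], and the second summand bounds everything of rank [r]. *)
Lemma card_sp_rank_transp_bound n r :
  #|@sp_rank_transp 'I_n r| * n.+1 <=
    #|@sp_rank 'I_n r| + n.+1 * 2 ^ (n.+1 ^ 7).
Proof.
have cn : #|'I_n| = n := card_ord n.
have [/andP[r_range V_large]|small] :=
  boolP ((0 < r < n) && (n.+1 ^ 5 <= 'C(n - 2, r.-1))); last first.
  have C_le : 'C(n, r) <= n.+1 ^ 7.
    have [r_range|] := boolP (0 < r < n).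
      move: small; rewrite r_range /= -ltnNge => /ltnW V_small.
      apply: leq_trans (leq_bin_middle r_range) _.
      rewrite -[7]/(2 + 5) expnD; apply: leq_mul V_small.
      by rewrite leq_exp2r.
    move=> r_range; apply: leq_trans (_ : 1 <= _); last by rewrite expn_gt0.
    have [->|r_gt0] := posnP r; first by rewrite bin0.
    have : n <= r by lia.
    by rewrite leq_eqVlt => /predU1P[->|/bin_small ->//]; rewrite binn.
  apply: leq_trans (leq_addl _ _); rewrite mulnC leq_mul2l /=.
  apply: leq_trans (_ : #|@sp_rank 'I_n r| <= _).
    by apply/subset_leq_card/subsetP=> M; rewrite inE => /andP[].
  apply: leq_trans (card_sp_rank_le _ _) _.
  by apply: leq_trans (card_codes_le _ _) _; rewrite cn leq_exp2l.
apply: leq_trans (leq_addr _ _).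
apply: leq_trans (card_sp_rank_ge _); last by rewrite cn.
set F := #|codes _ r|; pose k := F %/ n.+1 ^ 3.
have hk (i j : 'I_n) : i != j -> #|pairing_codes r i j| <= k.
  move=> ij; rewrite leq_divRL ?expn_gt0 //.
  have r_gt0 : 0 < r by case/andP: r_range.
  rewrite -(leq_pmul2r (_ : 0 < n.+1 ^ 2)) ?expn_gt0 // -mulnA -expnD.
  have := card_pairing_codes r_gt0 ij; rewrite cn; apply: leq_trans.
  by rewrite leq_mul2l V_large orbT.
apply: leq_trans (leq_mul (card_sp_rank_transp_le hk) (leqnn _)) _.
rewrite cn; apply: leq_trans (leq_trunc_div F (n.+1 ^ 3)).
by rewrite -/k mulnAC mulnC leq_mul2l (expnSr _ 2) leq_mul2r leq_exp2r // leqnSn !orbT.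
Qed.

Lemma s_Sigma2_bound n :
  s_Sigma2 n * n.+1 <= s n + n.+1 * (n.+1 * 2 ^ (n.+1 ^ 7)).
Proof.
rewrite /s_Sigma2 /s !card_by_rank big_distrl /=.
have card_sum : \sum_(r < #|'I_n|.+1) n.+1 * 2 ^ (n.+1 ^ 7) =
    n.+1 * (n.+1 * 2 ^ (n.+1 ^ 7)).
  by rewrite sum_nat_const !card_ord.
rewrite -card_sum -big_split /=; apply: leq_sum => r _.
apply: leq_trans (card_sp_rank_transp_bound n r).
rewrite leq_mul2r; apply/orP; right; apply/subset_leq_card/subsetP=> M.
by rewrite !inE -!andbA => /and3P[-> -> ->].
Qed.

Lemma expn10_le n : 80 <= n -> n.+1 ^ 10 <= 2 ^ n.
Proof.
move=> n80; pose k := n %/ 20.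
(* 4 is the least [k] with [20 * k.+1 <= 2 ^ (2 * k)], whence the threshold 80. *)
have k4 : 4 <= k by rewrite leq_divRL.
have nk : n < 20 * k.+1 by rewrite mulnC ltn_ceil.
have h4 : 20 * k.+1 <= 2 ^ (2 * k).
  elim: k k4 {nk} => // k IH; rewrite leq_eqVlt => /predU1P[<-//|/IH h].
  by rewrite (mulnS 2) expnD; lia.
apply: leq_trans (_ : (2 ^ (2 * k)) ^ 10 <= _).
  by rewrite leq_exp2r // (leq_trans nk).
by rewrite -expnM leq_exp2l // mulnAC mulnC leq_trunc_div.
Qed.

(** The Graham-Sloane code has at least [n.+1 ^ 8] words, since [2 ^ n] is at least [n.+1 ^ 10], and
    all its subfamilies are codes. The two terms [n.+1] in the exponent absorb the two factors
    [n.+1]. *)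
Lemma s_large n : 80 <= n -> n.+1 * (n.+1 * 2 ^ (n.+1 ^ 7)) <= s n.
Proof.
move=> n80; have n_gt0 : 0 < n by apply: leq_trans n80.
have [r [S [cS hS]]] := exists_large_code n_gt0.
have S_large : n.+1 ^ 7 + (n.+1 + n.+1) <= #|S|.
  apply: leq_trans (_ : n.+1 ^ 8 <= _).
    have : n.+1 <= n.+1 ^ 7 by rewrite -{1}(expn1 n.+1) leq_exp2l.
    by rewrite (expnSr _ 7); nia.
  rewrite -(leq_pmul2r (_ : 0 < n.+1 * n)) ?muln_gt0 ?n_gt0 //.
  apply: leq_trans hS; apply: leq_trans (expn10_le n80).
  by rewrite -[10]/(8 + 2) expnD leq_mul2l -mulnn leq_mul2l leqnSn !orbT.
(* Rank 0 and ranks at least [n] allow at most one word. *)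
have r_range : 0 < r < #|'I_n|.
  have S_gt1 : 1 < #|S| by apply: leq_trans S_large; lia.
  have [hc _] := codeP _ _ cS.
  have : #|S| <= 'C(#|'I_n|, r).
    rewrite -card_draws; apply/subset_leq_card/subsetP=> A /hc cA.
    by rewrite inE cA.
  rewrite card_ord; have [->|_] /= := posnP r; first by rewrite bin0 leqNgt S_gt1.
  rewrite ltnNge [n <= r]leq_eqVlt; apply: contraTN.
  by case/predU1P=> [<-|/bin_small ->]; rewrite ?binn -ltnNge // ltnW.
apply: leq_trans (_ : 2 ^ #|S| <= _).
  apply: leq_trans (_ : 2 ^ (n.+1 ^ 7 + (n.+1 + n.+1)) <= _); last by rewrite leq_exp2l.
  rewrite !expnD mulnA mulnC leq_mul2l; apply/orP; right.
  by apply: leq_mul; apply/ltnW/ltn_expl.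
apply: leq_trans (card_codes_ge cS) _; apply: leq_trans (card_sp_rank_ge r_range) _.
by apply/subset_leq_card/subsetP=> M; rewrite !inE => /andP[].
Qed.

(* Passage to the limit *)
From mathcomp Require Import all_boot all_order all_algebra.
From mathcomp Require Import all_classical all_reals all_analysis.
Import Order.TTheory GRing.Theory Num.Theory.
Import numFieldNormedType.Exports.
Local Open Scope classical_set_scope.
Local Open Scope ring_scope.

Theorem theorem3p2 (R : realType) :
  (fun n : nat => (s_Sigma2 n)%:R / (s n)%:R : R) @ \oo --> (0 : R).
Proof.
(* For [n] at least 80 the error term of [s_Sigma2_bound] is at most [s n], so the ratio is at most
   [2 / n.+1]. *)
apply: (@squeeze_cvgr _ _ _ _ (cst 0) (fun n => 2 * harmonic n)).
- near=> n; have n80 : (80 <= n)%N by near: n; exact: nbhs_infty_ge.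
  rewrite divr_ge0 ?ler0n //= ler_pdivrMr; last first.
    by rewrite ltr0n (leq_trans _ (s_large n80)) // !muln_gt0 expn_gt0.
  rewrite mulrAC ler_pdivlMr ?ltr0n // -!natrM ler_nat.
  have := s_Sigma2_bound n; have := s_large n80.
  by rewrite mul2n -addnn => h1 h2; apply: leq_trans h2 _; rewrite leq_add2l.
- exact: cvg_cst.
- by rewrite -[0 in X in _ --> X](mulr0 2); apply: cvgMr; exact: cvg_harmonic.
Unshelve. all: by end_near. Qed.
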